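(* Let $\Delta$ be an irreducible reduced root system not of type $A_n$, let $S\subset\Pi_l$, and let $\gamma$ be a maximal element (with respect to $\preccurlyeq$) of $\Delta^+\setminus\bigcup_{\alpha\in S}I(\alpha)_{\sf max}$. Then $\gamma\in\mathcal H$.
   Context: $\Delta^+$, $\Pi$, $\theta$: positive roots, simple roots, highest root; $W$ the Weyl group, $(\ ,\ )$ a $W$-invariant inner product; $\mu\preccurlyeq\nu$ iff $\nu-\mu$ is a non-negative integral combination of simple roots. $\Delta^+_l$ is the set of long positive roots and $\Pi_l=\Pi\cap\Delta^+_l$ (all roots are long in the simply-laced case). $\mathcal H=\{\gamma\in\Delta^+\mid(\gamma,\theta)>0\}$. An upper ideal of $\Delta^+$ is $I\subset\Delta^+$ with $\gamma\in I,\nu\in\Delta^+,\nu+\gamma\in\Delta^+\Rightarrow\nu+\gamma\in I$; it is abelian if $\gamma'+\gamma''\notin\Delta^+$ for all $\gamma',\gamma''\in I$. For $w\in W$, $N(w)=\{\gamma\in\Delta^+\mid w(\gamma)\in-\Delta^+\}$. For $\mu\in\Delta^+_l$, let $w_\mu$ be the unique element of minimal length in $W$ with $w_\mu(\theta)=\mu$, and set $I(\mu)_{\sf min}=\{\theta\}\cup\{\theta-\gamma\mid\gamma\in N(w_\mu)\}$; this is an abelian upper ideal contained in $\mathcal H$. It is known that among nonempty abelian upper ideals $I$ with $I\cap\mathcal H=I(\mu)_{\sf min}$ there is a unique maximal one, denoted $I(\mu)_{\sf max}$; the ideals $I(\alpha)_{\sf max}$, $\alpha\in\Pi_l$, are exactly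 the maximal abelian upper ideals of $\Delta^+$. *)

(* Defs.v *)
From HB Require Import structures.
From mathcomp Require Import all_boot all_order all_algebra.
Set Implicit Arguments. Unset Strict Implicit. Unset Printing Implicit Defensive.
Import Order.TTheory GRing.Theory Num.Theory.
Local Open Scope ring_scope.

Section RootSystems.
Variables (R : realFieldType) (n : nat).
Notation V := 'rV[R]_n.

Definition dot (u v : V) : R := (u *m v^T) 0 0.

Definition refl (a v : V) : V := v - (2 * dot v a / dot a a) *: a.

Definition rowsmx (s : seq V) : 'M[R]_(size s, n) := \matrix_(i < size s, j < n) (s`_i) 0 j.

Definition root_system (Phi : seq V) : Prop :=
  [/\ 0 \notin Phi,
      \rank (rowsmx Phi) = n,
      (forall a b, a \in Phi -> b \in Phi -> refl a b \in Phi),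
      (forall a b, a \in Phi -> b \in Phi ->
          exists z : int, 2 * dot b a / dot a a = z%:~R) &
      (forall a (c : R), a \in Phi -> c *: a \in Phi -> c = 1 \/ c = -1)].

Definition irreducible (Phi : seq V) : Prop :=
  Phi != [::] /\
  forall P : pred V,
    (forall a b, a \in Phi -> b \in Phi -> P a -> ~~ P b -> dot a b = 0) ->
    all P Phi \/ all (predC P) Phi.

Definition A_roots (m : nat) (w : 'rV[R]_m.+1) : Prop :=
  exists i j : 'I_m.+1, i != j /\ w = delta_mx 0 i - delta_mx 0 j.

Definition typeA (Phi : seq V) : Prop :=
  exists m : nat, exists f : 'M[R]_(n, m.+1),
    (0 < m)%N /\ row_free f /\
    forall w, A_roots w <-> exists2 v, v \in Phi & v *m f = w.

Definition nncomb (Pi : seq V) (v : V) : Prop :=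
  exists k : 'I_(size Pi) -> nat, v = \sum_(i < size Pi) (k i)%:R *: Pi`_i.

Definition is_base (Phi Pi : seq V) : Prop :=
  [/\ {subset Pi <= Phi}, uniq Pi, row_free (rowsmx Pi) &
      forall b, b \in Phi -> nncomb Pi b \/ nncomb Pi (- b)].

Definition posroot (Phi Pi : seq V) (b : V) : Prop := b \in Phi /\ nncomb Pi b.

Definition rprec (Pi : seq V) (mu nu : V) : Prop := nncomb Pi (nu - mu).

Definition highest_root (Phi Pi : seq V) (theta : V) : Prop :=
  posroot Phi Pi theta /\ forall b, posroot Phi Pi b -> rprec Pi b theta.

Definition long_root (Phi : seq V) (a : V) : Prop :=
  a \in Phi /\ forall b, b \in Phi -> dot b b <= dot a a.

Definition Hset (Phi Pi : seq V) (theta gamma : V) : Prop :=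
  posroot Phi Pi gamma /\ 0 < dot gamma theta.

Definition upper_ideal (Phi Pi : seq V) (I : V -> Prop) : Prop :=
  (forall x, I x -> posroot Phi Pi x) /\
  forall g nu, I g -> posroot Phi Pi nu -> posroot Phi Pi (nu + g) -> I (nu + g).

Definition abelian (Phi Pi : seq V) (I : V -> Prop) : Prop :=
  forall g1 g2, I g1 -> I g2 -> ~ posroot Phi Pi (g1 + g2).

(* Weyl group elements, given by words in the simple reflections:
   wact s = s_{i1} o s_{i2} o ... o s_{ik} for s = [:: i1; ...; ik] *)
Definition wact (Pi : seq V) (s : seq 'I_(size Pi)) (v : V) : V :=
  foldr (fun (i : 'I_(size Pi)) (x : V) => refl Pi`_i x) v s.

(* s is a reduced word for w_mu, the minimal length element with w(theta)=mu *)
Definition min_word (Pi : seq V) (theta mu : V) (s : seq 'I_(size Pi)) : Prop :=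
  wact s theta = mu /\
  forall t : seq 'I_(size Pi), wact t theta = mu -> (size s <= size t)%N.

(* I(mu)_min computed from a word s for w_mu *)
Definition Imin (Phi Pi : seq V) (theta : V) (s : seq 'I_(size Pi)) (x : V) : Prop :=
  x = theta \/
  exists g, [/\ posroot Phi Pi g, posroot Phi Pi (- wact s g) & x = theta - g].

Definition nonempty_abelian_ideal (Phi Pi : seq V) (I : V -> Prop) : Prop :=
  (exists x, I x) /\ upper_ideal Phi Pi I /\ abelian Phi Pi I.

Definition is_Imax (Phi Pi : seq V) (theta mu : V) (I : V -> Prop) : Prop :=
  exists s : seq 'I_(size Pi),
  [/\ min_word theta mu s,
      nonempty_abelian_ideal Phi Pi I,
      (forall x, I x /\ Hset Phi Pi theta x <-> Imin Phi theta s x) &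
      (forall J : V -> Prop, nonempty_abelian_ideal Phi Pi J ->
         (forall x, J x /\ Hset Phi Pi theta x <-> Imin Phi theta s x) ->
         forall x, J x -> I x)].

End RootSystems.

Arguments wact {R n} Pi s v.
Arguments min_word {R n} Pi theta mu s.
Arguments Imin {R n} Phi Pi theta s x.

(* Main.v *)
Require Import Defs.
From HB Require Import structures.
From mathcomp Require Import all_boot all_order all_algebra.
From mathcomp Require Import ring lra zify.
Import Order.TTheory GRing.Theory Num.Theory.
Local Open Scope ring_scope.

(** When the type is not A, the highest root [theta] is orthogonal to all simple
    roots but one, [a_t]: if two simple roots pair positively with [theta], the
    sum of all simple roots is [theta], dominance of [theta] forces the Dynkin
    diagram to be a path, and the roots are the interval sums of that path.

    Suppose [gamma] is not in [H], that is, [a_t] is not in the support of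
    [gamma].  The Dynkin diagram has no cycles, so there is a single simple root
    [d] adjacent to the support of [gamma] on the way to [a_t], and every root
    of [H] above [gamma] is above the root [gamma + d].  An upper ideal is
    abelian as soon as no two of its elements add up to [theta], and two such
    elements lie in [H].  Hence an ideal [I_max] containing [gamma + d] can be
    enlarged by all roots above [gamma] without changing its intersection with
    [H], and by maximality it contains [gamma].  So [gamma + d] avoids every
    [I_max] that [gamma] avoids, and [gamma] is not maximal. *)

(** * The inner product on row vectors *)

Section Dot.
Context {R : realFieldType} {n : nat}.
Implicit Types u v w : 'rV[R]_n.

Lemma dotE u v : dot u v = \sum_i u 0 i * v 0 i.
Proof. by rewrite /dot mxE; apply: eq_bigr => i _; rewrite mxE. Qed.

Lemma dotC u v : dot u v = dot v u.
Proof. by rewrite !dotE; apply: eq_bigr => i _; rewrite mulrC. Qed.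

Lemma dotDl u v w : dot (u + v) w = dot u w + dot v w.
Proof. by rewrite /dot mulmxDl mxE. Qed.

Lemma dotZl k u v : dot (k *: u) v = k * dot u v.
Proof. by rewrite /dot -scalemxAl mxE. Qed.

Lemma dotNl u v : dot (- u) v = - dot u v.
Proof. by rewrite -scaleN1r dotZl mulN1r. Qed.

Lemma dotBl u v w : dot (u - v) w = dot u w - dot v w.
Proof. by rewrite dotDl dotNl. Qed.

Lemma dot0l v : dot 0 v = 0.
Proof. by rewrite -(scale0r 0) dotZl mul0r. Qed.

Lemma dotDr u v w : dot u (v + w) = dot u v + dot u w.
Proof. by rewrite dotC dotDl !(dotC u). Qed.

Lemma dotZr k u v : dot u (k *: v) = k * dot u v.
Proof. by rewrite dotC dotZl dotC. Qed.

Lemma dotNr u v : dot u (- v) = - dot u v.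
Proof. by rewrite dotC dotNl dotC. Qed.

Lemma dotBr u v w : dot u (v - w) = dot u v - dot u w.
Proof. by rewrite dotDr dotNr. Qed.

Lemma dot_suml (I : Type) (r : seq I) (P : pred I) (F : I -> 'rV[R]_n) v :
  dot (\sum_(i <- r | P i) F i) v = \sum_(i <- r | P i) dot (F i) v.
Proof.
by elim/big_rec2: _ => [|i x y _ <-]; rewrite ?dot0l ?dotDl.
Qed.

Lemma dotxx_ge0 u : 0 <= dot u u.
Proof. by rewrite dotE sumr_ge0 // => i _; rewrite -expr2 sqr_ge0. Qed.

Lemma dotxx_eq0 u : (dot u u == 0) = (u == 0).
Proof.
apply/idP/eqP => [|->]; last by rewrite dot0l.
rewrite dotE psumr_eq0 => [/allP u0|i _]; last by rewrite -expr2 sqr_ge0.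
apply/rowP => i; rewrite mxE.
by have := u0 i (mem_index_enum i); rewrite mulf_eq0 orbb => /eqP.
Qed.

Lemma dotxx_gt0 u : u != 0 -> 0 < dot u u.
Proof. by move=> u0; rewrite lt_def dotxx_eq0 u0 dotxx_ge0. Qed.

Definition dotp := (dotDl, dotBl, dotNl, dotZl, dotDr, dotBr, dotNr, dotZr).

(** The difference of [u] and its projection on [v] is nonzero, so it has positive norm. *)
Lemma strict_Cauchy_Schwarz u v :
  v != 0 -> (forall k, u <> k *: v) -> dot u v ^+ 2 < dot u u * dot v v.
Proof.
move=> v0 uNv; have vv := dotxx_gt0 _ v0.
have /dotxx_gt0 : u - (dot u v / dot v v) *: v != 0.
  by rewrite subr_eq0; apply/eqP.
set k := dot u v / dot v v.
have ek : dot u v = k * dot v v by rewrite /k divfK // gt_eqF.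
rewrite !dotp (dotC v u) ek => lt0; clearbody k; nra.
Qed.

End Dot.

(** * Maxima and induction along a real-valued function on a finite sequence *)

Section FiniteInduction.
Context {R : realFieldType} {T : eqType}.
Implicit Types (s : seq T) (f : T -> R) (P : pred T).

Lemma exists_argmax s f P : has P s ->
  exists x, [/\ x \in s, P x & forall y, y \in s -> P y -> f y <= f x].
Proof.
elim: s => //= a s IH.
have [/IH[x [xs Px xmax]] _|/hasPn hs] := boolP (has P s); last first.
  rewrite orbF => Pa; exists a; split; rewrite ?mem_head// => y.
  by rewrite inE => /predU1P[->//|/hs/negP].
have [/andP[Pa lxa]|] := boolP (P a && (f x <= f a)).
  exists a; split; rewrite ?mem_head// => y; rewrite inE => /predU1P[->//|ys Py].
  by rewrite (le_trans (xmax _ ys Py)).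
rewrite negb_and -ltNge => aNmax.
exists x; split; rewrite ?in_cons ?xs ?orbT// => y; rewrite inE => /predU1P[->|].
  by move=> Pa; move: aNmax; rewrite Pa => /ltW.
exact: xmax.
Qed.

(** Well founded although [f] takes values in an ordered field: the number of entries of [s] with a
    larger value than [x] drops when [x] is replaced by an entry of larger value. It is mostly used
    with [f] the height. *)
Lemma seq_up_ind s f (Q : T -> Prop) :
  (forall x, x \in s -> (forall y, y \in s -> f x < f y -> Q y) -> Q x) ->
  forall x, x \in s -> Q x.
Proof.
move=> step x; have [m] := ubnP (count (fun y => f x < f y) s).
elim: m x => // m IH x cx xs; apply: step => // y ys lxy; apply: IH => //.
rewrite -ltnS; apply: leq_trans cx; rewrite ltnS.
elim: s ys {xs} => //= a s IHs.
have sub : (count (fun z => (f y < f z)%R) s <= count (fun z => (f x < f z)%R) s)%N.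
  by apply: sub_count => z /=; apply: lt_trans.
rewrite inE => /predU1P[<-|/IHs {}IHs]; first by rewrite ltxx lxy add0n add1n ltnS.
by rewrite -addnS leq_add//; case: ltP => // /(lt_trans lxy) ->.
Qed.

Lemma seq_down_ind s f (Q : T -> Prop) :
  (forall x, x \in s -> (forall y, y \in s -> f y < f x -> Q y) -> Q x) ->
  forall x, x \in s -> Q x.
Proof.
move=> step; apply: (@seq_up_ind s (fun x => - f x)) => x xs IH.
by apply: step => // y ys; rewrite -ltrN2 => /IH; apply.
Qed.

End FiniteInduction.

(** * Sums and differences of roots *)

Section RootSystem.
Context {R : realFieldType} {n : nat} {Phi : seq 'rV[R]_n}.
Hypothesis rsPhi : root_system Phi.
Implicit Types a b c : 'rV[R]_n.

Lemma root_neq0 a : a \in Phi -> a != 0.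
Proof. by case: rsPhi => N0 _ _ _ _; apply: contraTneq => ->. Qed.

Lemma root_gt0 a : a \in Phi -> 0 < dot a a.
Proof. by move/root_neq0/dotxx_gt0. Qed.

Lemma root_refl a b : a \in Phi -> b \in Phi -> refl a b \in Phi.
Proof. by case: rsPhi => _ _ H _ _; apply: H. Qed.

Lemma root_opp a : a \in Phi -> - a \in Phi.
Proof.
move=> aP; have := root_refl _ _ aP aP.
rewrite /refl mulfK ?gt_eqF ?root_gt0// -[X in X - _]scale1r -scalerBl.
by rewrite (_ : 1 - 2 = -1 :> R) ?scaleN1r //; lra.
Qed.

Lemma dot_refl a b : a \in Phi -> dot (refl a b) (refl a b) = dot b b.
Proof.
move=> /root_gt0 a0; rewrite /refl !dotp (dotC a b).
by field; rewrite gt_eqF.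
Qed.

Lemma cartan_int a b : a \in Phi -> b \in Phi ->
  exists z : int, 2 * dot b a = z%:~R * dot a a.
Proof.
case: rsPhi => _ _ _ H _ aP bP; have [z ez] := H _ _ aP bP; exists z.
by rewrite -ez divfK // gt_eqF ?root_gt0.
Qed.

Lemma cartan_gt0 a b : a \in Phi -> b \in Phi -> 0 < dot b a ->
  dot a a <= 2 * dot b a.
Proof.
move=> aP bP ba; have [z ez] := cartan_int _ _ aP bP.
have a0 := root_gt0 _ aP; rewrite ez ler_peMl ?(ltW a0) //.
have : 0 < z%:~R * dot a a by rewrite -ez mulr_gt0.
by rewrite pmulr_lgt0 // ltr0z gtz0_ge1 -(ler_int R).
Qed.

Lemma cartan_lt0 a b : a \in Phi -> b \in Phi -> dot b a < 0 ->
  2 * dot b a <= - dot a a.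
Proof.
move=> aP bP ba; have := cartan_gt0 _ _ aP (root_opp _ bP).
by rewrite dotNl oppr_gt0 mulrN lerNr => /(_ ba).
Qed.

Lemma roots_Cauchy_Schwarz a b : a \in Phi -> b \in Phi -> a != b -> a != - b ->
  dot a b ^+ 2 < dot a a * dot b b.
Proof.
move=> aP bP ab aNb; apply: strict_Cauchy_Schwarz; first exact: root_neq0.
move=> k ak; case: rsPhi => _ _ _ _ H.
have [k1|k1] := H b k bP ltac:(by rewrite -ak).
  by move: ab; rewrite ak k1 scale1r eqxx.
by move: aNb; rewrite ak k1 scaleN1r eqxx.
Qed.

(** By strict Cauchy-Schwarz the two Cartan integers have product less than 4. Both are negative, so
    one of them is -1, and the corresponding reflection produces [a + b]. *)
Lemma root_add a b : a \in Phi -> b \in Phi -> dot a b < 0 -> a + b != 0 ->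
  a + b \in Phi.
Proof.
move=> aP bP ab0; rewrite addr_eq0 => aNb.
have a0 := root_gt0 _ aP; have b0 := root_gt0 _ bP.
have ab : a != b by apply: contraTneq ab0 => ->; rewrite -leNgt ltW.
have CS := roots_Cauchy_Schwarz _ _ aP bP ab aNb.
have [z ez] := cartan_int _ _ bP aP; have [y ey] := cartan_int _ _ aP bP.
rewrite dotC in ey.
have zy : z%:~R * y%:~R < 4 :> R.
  rewrite -(ltr_pM2r (mulr_gt0 a0 b0)) (mulrC (dot a a)) mulrACA -ez -ey; lra.
have z0 : z < 0.
  have : z%:~R * dot b b < 0 by rewrite -ez pmulr_rlt0.
  by rewrite pmulr_llt0 // ltrz0.
have y0 : y < 0.
  have : y%:~R * dot a a < 0 by rewrite -ey pmulr_rlt0.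
  by rewrite pmulr_llt0 // ltrz0.
have {}zy : z * y < 4 by move: zy; rewrite -intrM -[4]/(4%:~R) ltr_int.
have /orP[/eqP z1|/eqP y1] : (z == -1) || (y == -1) by nia.
  have := root_refl _ _ bP aP; rewrite /refl ez mulfK ?gt_eqF // z1.
  by rewrite mulrN1z scaleN1r opprK.
have := root_refl _ _ aP bP; rewrite /refl dotC ey mulfK ?gt_eqF // y1.
by rewrite mulrN1z scaleN1r opprK addrC.
Qed.

Lemma root_sub a b : a \in Phi -> b \in Phi -> 0 < dot a b -> a != b ->
  a - b \in Phi.
Proof.
move=> aP bP ab anb; apply: root_add => //; first exact: root_opp.
  by rewrite dotNr oppr_lt0.
by rewrite subr_eq0.
Qed.

(** If [c] has a negative product with [a] or [b], add it there. Otherwise [c] has a nonnegative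
    product with [a + b], so [a + b + c] has a positive product with [a + b], hence with [a] or with
    [b], and that summand can be subtracted. *)
Lemma root_add3 a b c : a \in Phi -> b \in Phi -> c \in Phi ->
  a + b \in Phi -> a + b + c \in Phi ->
  a + c != 0 -> b + c != 0 -> a + c \in Phi \/ b + c \in Phi.
Proof.
move=> aP bP cP abP abcP ac0 bc0.
have [/root_add|ac] := ltP (dot a c) 0; first by left; auto.
have [/root_add|bc] := ltP (dot b c) 0; first by right; auto.
have [da|da] := ltP 0 (dot (a + b + c) a).
  right; have -> : b + c = a + b + c - a by rewrite -(addrA a) addrAC subrr add0r.
  apply: root_sub => //; apply: contraNneq bc0 => e.
  by apply/eqP; apply: (addrI a); rewrite addrA e addr0.
have [db|db] := ltP 0 (dot (a + b + c) b).
  left; have -> : a + c = a + b + c - b by rewrite (addrAC a) addrK.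
  apply: root_sub => //; apply: contraNneq ac0 => e.
  by apply/eqP; apply: (addrI b); rewrite addrCA addrA e addr0.
have := root_gt0 _ abP; move: da db; rewrite !dotp !(dotC c) (dotC b a); lra.
Qed.

End RootSystem.

(** * Coordinates in a base *)

Section Base.
Context {R : realFieldType} {n : nat} {Phi Pi : seq 'rV[R]_n}.
Hypotheses (rsPhi : root_system Phi) (basePi : is_base Phi Pi).
Implicit Types (u v w x y : 'rV[R]_n) (i j k : 'I_(size Pi)).

Definition simple i : 'rV[R]_n := Pi`_i.

(** Coordinates in the base, valued in [R]; integrality on roots is proved separately. The number of
    simple roots is not [n] by definition, hence a pseudo-inverse instead of an inverse matrix. *)
Definition coef x i : R := (x *m pinvmx (rowsmx Pi)) 0 i.

(** A boolean form of [rprec]; the two agree on roots, whose coordinates are integers. *)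
Definition coef_le x y := [forall i, coef x i <= coef y i].

Definition height x : R := \sum_i coef x i.

Lemma simple_root i : simple i \in Phi.
Proof. by case: basePi => sub _ _ _; apply/sub/mem_nth. Qed.

Lemma simple_gt0 i : 0 < dot (simple i) (simple i).
Proof. exact: root_gt0 rsPhi _ (simple_root i). Qed.

Lemma row_rowsmx (s : seq 'rV[R]_n) (i : 'I_(size s)) : row i (rowsmx s) = s`_i.
Proof. by apply/rowP => j; rewrite !mxE. Qed.

Lemma base_row_full : row_full (rowsmx Pi).
Proof.
have [_ rkPhi _ _ _] := rsPhi; have [_ _ _ H] := basePi.
rewrite /row_full eqn_leq rank_leq_col -{1}rkPhi mxrankS //.
have sub v : nncomb Pi v -> (v <= rowsmx Pi)%MS.
  move=> [k ->]; apply: summx_sub => i _; apply: scalemx_sub.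
  by rewrite -row_rowsmx row_sub.
apply/row_subP => i; rewrite row_rowsmx.
have [/sub//|/sub] := H _ (mem_nth 0 (ltn_ord i)).
by rewrite eqmx_opp.
Qed.

Lemma coefD x y i : coef (x + y) i = coef x i + coef y i.
Proof. by rewrite /coef mulmxDl mxE. Qed.

Lemma coefN x i : coef (- x) i = - coef x i.
Proof. by rewrite /coef mulNmx mxE. Qed.

Lemma coefB x y i : coef (x - y) i = coef x i - coef y i.
Proof. by rewrite coefD coefN. Qed.

Lemma coefZ a x i : coef (a *: x) i = a * coef x i.
Proof. by rewrite /coef -scalemxAl mxE. Qed.

Lemma coef_sum (I : Type) (r : seq I) (P : pred I) (F : I -> 'rV[R]_n) i :
  coef (\sum_(l <- r | P l) F l) i = \sum_(l <- r | P l) coef (F l) i.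
Proof. by rewrite /coef mulmx_suml summxE. Qed.

Lemma coef_simple i j : coef (simple i) j = (i == j)%:R.
Proof.
rewrite /coef /simple -row_rowsmx -row_mul mulmxVp; last by case: basePi.
by rewrite rowE mulmx1 mxE eqxx eq_sym.
Qed.

Lemma coefE x : x = \sum_i coef x i *: simple i.
Proof.
rewrite -{1}[x]mulmx1 -(mulVpmx base_row_full) mulmxA mulmx_sum_row.
by apply: eq_bigr => i _; rewrite row_rowsmx.
Qed.

Lemma coef_inj x y : coef x =1 coef y -> x = y.
Proof.
by move=> xy; rewrite (coefE x) (coefE y); apply: eq_bigr => i _; rewrite xy.
Qed.

Lemma dot_coefl x y : dot x y = \sum_i coef x i * dot (simple i) y.
Proof.
by rewrite {1}(coefE x) dot_suml; apply: eq_bigr => i _; rewrite dotZl.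
Qed.

Lemma nncombP x : nncomb Pi x <->
  exists k : 'I_(size Pi) -> nat, forall i, coef x i = (k i)%:R.
Proof.
split=> [[k ->]|[k xk]]; exists k; first move=> i.
  rewrite coef_sum (bigD1 i)//= coefZ (coef_simple i) eqxx mulr1 big1 ?addr0 // => j ji.
  by rewrite coefZ (coef_simple j) (negPf ji) mulr0.
by rewrite [LHS]coefE; apply: eq_bigr => i _; rewrite xk.
Qed.

Lemma coef_int x i : x \in Phi -> exists z : int, coef x i = z%:~R.
Proof.
case: basePi => _ _ _ H /H[] /nncombP[k xk]; first by exists (k i)%:Z; rewrite xk.
by exists (- (k i)%:Z); rewrite -[x]opprK coefN xk mulrNz.
Qed.

Definition pos x := coef_le 0 x.

Lemma coef0 i : coef 0 i = 0.
Proof. by rewrite -(scale0r 0) coefZ mul0r. Qed.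

Lemma posP x : reflect (forall i, 0 <= coef x i) (pos x).
Proof. by apply: (iffP forallP) => H i; move: (H i); rewrite coef0. Qed.

Lemma coef_leP x y : reflect (forall i, coef x i <= coef y i) (coef_le x y).
Proof. exact: forallP. Qed.

Lemma coef_le_refl x : coef_le x x.
Proof. exact/coef_leP. Qed.

Lemma coef_le_trans y x z : coef_le x y -> coef_le y z -> coef_le x z.
Proof. by move=> /coef_leP xy /coef_leP yz; apply/coef_leP => i; apply: le_trans (yz i). Qed.

Lemma nncomb_pos x : nncomb Pi x -> pos x.
Proof. by move=> /nncombP[k xk]; apply/posP => i; rewrite xk ler0n. Qed.

Lemma root_pos_or_neg x : x \in Phi -> pos x \/ pos (- x).
Proof. by case: basePi => _ _ _ H /H[] /nncomb_pos; [left|right]. Qed.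

Lemma pos_coef_gt0 x : x \in Phi -> pos x -> exists i, 0 < coef x i.
Proof.
move=> xP /posP x0; apply/existsP; apply: contraT => /existsPn xN.
case/negP: (root_neq0 rsPhi _ xP); apply/eqP/coef_inj => i.
by rewrite coef0; apply/eqP; rewrite eq_le x0 leNgt xN.
Qed.

Lemma root_pos x i : x \in Phi -> 0 < coef x i -> pos x.
Proof.
move=> xP xi; have [//|/posP/(_ i)] := root_pos_or_neg _ xP.
by rewrite coefN oppr_ge0 leNgt xi.
Qed.

Lemma posrootP x : posroot Phi Pi x <-> x \in Phi /\ pos x.
Proof.
split=> [[xP /nncomb_pos]//|[xP xpos]]; split=> //.
case: basePi => _ _ _ /(_ _ xP)[//|/nncomb_pos/posP x0].
have [i] := pos_coef_gt0 _ xP xpos.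
by move: (x0 i); rewrite coefN oppr_ge0 leNgt => /negP.
Qed.

Lemma coef_int_lt x y i : x \in Phi -> y \in Phi -> coef x i < coef y i ->
  coef x i + 1 <= coef y i.
Proof.
move=> /(coef_int _ i)[z ->] /(coef_int _ i)[z' ->].
by rewrite -[1]/(1%:~R) -intrD ltr_int ler_int -lezD1.
Qed.

Lemma coef_ge1 x i : x \in Phi -> 0 < coef x i -> 1 <= coef x i.
Proof.
move=> /(coef_int _ i)[z ->].
by rewrite -[1]/(1%:~R) ltr0z ler_int gtz0_ge1.
Qed.

Lemma rprecP x y : x \in Phi -> y \in Phi -> rprec Pi x y <-> coef_le x y.
Proof.
move=> xP yP; split=> [/nncomb_pos/posP xy|/coef_leP xy].
  by apply/coef_leP => i; rewrite -subr_ge0 -coefB.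
apply/nncombP; have nat_diff i : exists k : nat, coef (y - x) i == k%:R.
  rewrite coefB; have := xy i.
  have [[a ->] [b ->]] := (coef_int _ i xP, coef_int _ i yP).
  rewrite ler_int => ab; exists `|b - a|%N.
  rewrite -mulrzBr pmulrn; apply/eqP; congr (_ *~ _).
  by rewrite gez0_abs // subr_ge0.
by exists (fun i => xchoose (nat_diff i)) => i; apply/eqP/(xchooseP (nat_diff i)).
Qed.

Lemma heightD x y : height (x + y) = height x + height y.
Proof. by rewrite -big_split; apply: eq_bigr => i _; rewrite coefD. Qed.

Lemma height_simple i : height (simple i) = 1.
Proof.
rewrite /height (bigD1 i) //= coef_simple eqxx big1 ?addr0 // => j /negPf ji.
by rewrite coef_simple eq_sym ji.
Qed.

Lemma heightN x : height (- x) = - height x.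
Proof. by rewrite /height -sumrN; apply: eq_bigr => i _; rewrite coefN. Qed.

Lemma heightZ a x : height (a *: x) = a * height x.
Proof. by rewrite /height mulr_sumr; apply: eq_bigr => i _; rewrite coefZ. Qed.

Lemma dot_simple_le0 i j : i != j -> dot (simple i) (simple j) <= 0.
Proof.
move=> ij; rewrite leNgt; apply/negP => /root_sub-/(_ Phi rsPhi).
move=> /(_ (simple_root i) (simple_root j)).
have -> : simple i != simple j.
  apply: contraNneq ij => /(congr1 (coef^~ i)); rewrite !coef_simple eqxx.
  by case: eqVneq => // _ /eqP; rewrite oner_eq0.
move=> /(_ isT) ijP.
have := root_pos _ i ijP; rewrite coefB !coef_simple eqxx eq_sym (negPf ij) subr0 ltr01.
move=> /(_ isT)/posP/(_ j); rewrite coefB !coef_simple eqxx (negPf ij) sub0r.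
by rewrite oppr_ge0 leNgt ltr01.
Qed.

Lemma coef_le_sub_simple x y i : x \in Phi -> y \in Phi ->
  coef_le x y -> coef x i < coef y i -> coef_le x (y - simple i).
Proof.
move=> xP yP /coef_leP xy xi; apply/coef_leP => j; rewrite coefB coef_simple.
case: eqVneq => [<-|_]; last by rewrite subr0.
by rewrite lerBrDr coef_int_lt.
Qed.

Lemma coef_le_add_simple x y i : x \in Phi -> y \in Phi ->
  coef_le x y -> coef x i < coef y i -> coef_le (x + simple i) y.
Proof.
move=> xP yP /coef_leP xy xi; apply/coef_leP => j; rewrite coefD coef_simple.
by case: eqVneq => [<-|_]; rewrite ?addr0 // coef_int_lt.
Qed.

Lemma coef_le_addl x y i : coef_le (x + simple i) y -> coef_le x y.
Proof.
move=> /coef_leP xy; apply/coef_leP => j; apply: le_trans (xy j).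
by rewrite coefD coef_simple lerDl ler0n.
Qed.

(** * Chains of roots and connectedness of supports *)

Lemma posrootD_neq0 x y : x \in Phi -> pos x -> pos y -> x + y != 0.
Proof.
move=> xP x0 /posP y0; have [i xi] := pos_coef_gt0 _ xP x0.
apply/eqP => /(congr1 (coef^~ i)); rewrite coefD coef0.
by apply/eqP; rewrite gt_eqF // ltr_wpDr.
Qed.

Lemma pos_simple i : pos (simple i).
Proof. by apply/posP => j; rewrite coef_simple ler0n. Qed.

Lemma pos_le x y : pos x -> coef_le x y -> pos y.
Proof. exact: coef_le_trans. Qed.

(** As [y - x] has positive norm, some simple root [i] in its support has positive product with it.
    If [i] has negative product with [x], then [x + i] is a root; otherwise it has positive product
    with [y], and the induction continues with the root [y - i], still above [x]. *)
Lemma root_climb x y : x \in Phi -> pos x -> y \in Phi -> coef_le x y -> x != y ->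
  exists2 i, x + simple i \in Phi & coef_le (x + simple i) y.
Proof.
move=> xP x0; move: y; apply: (@seq_down_ind _ _ _ height) => y yP IH xy xNy.
have : 0 < dot (y - x) (y - x) by rewrite dotxx_gt0 // subr_eq0 eq_sym.
have [/existsP[i /andP[xi xyi]] _|/existsPn H] :=
  boolP [exists i, (coef x i < coef y i) && (0 < dot (simple i) (y - x))]; last first.
  rewrite dot_coefl ltNge sumr_le0 // => i _; rewrite coefB.
  have := H i; move: (coef_leP _ _ xy i); rewrite le_eqVlt => /predU1P[->|xi].
    by rewrite subrr mul0r.
  by rewrite xi -leNgt; apply: mulr_ge0_le0; rewrite subr_ge0 ltW.
have le1 := coef_le_add_simple _ _ _ xP yP xy xi.
move: xyi; rewrite dotBr subr_gt0 => xyi.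
have [xi0|xi0] := ltP (dot (simple i) x) 0.
  exists i => //; apply: (root_add rsPhi) => //; first exact: simple_root.
    by rewrite dotC.
  by rewrite posrootD_neq0 ?pos_simple.
have yNi : y != simple i.
  apply: contraTneq xy => yi; apply/negP => /coef_leP xy.
  have [j xj] := pos_coef_gt0 _ xP x0.
  have := coef_ge1 _ _ xP xj; have := xy j; rewrite yi coef_simple.
  case: eqVneq => [ij _ x1|_ l0]; last by rewrite leNgt (le_lt_trans l0) ?ltr01.
  by move: xi; rewrite yi coef_simple eqxx ij ltNge x1.
have yiP : y - simple i \in Phi.
  apply: (root_sub rsPhi) => //; first exact: simple_root.
  by rewrite dotC (le_lt_trans xi0).
have le2 := coef_le_sub_simple _ _ _ xP yP xy xi.
have [e|ne] := eqVneq x (y - simple i).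
  by exists i; rewrite e subrK // coef_le_refl.
have [|j xjP xjy] := IH _ yiP _ le2 ne.
  by rewrite heightD heightN height_simple gtrBl ltr01.
exists j => //; apply: coef_le_trans xjy _; apply/coef_leP => l.
by rewrite coefB coef_simple gerBl ler0n.
Qed.

(** An upper ideal is closed only under sums that are roots; a chain of roots from [x] to [y] with
    simple steps reduces the claim to such sums. *)
Lemma upper_ideal_coef_le (I : 'rV[R]_n -> Prop) x y : upper_ideal Phi Pi I ->
  I x -> y \in Phi -> coef_le x y -> I y.
Proof.
move=> [Isub Iup] + yP.
have [|xP] := boolP (x \in Phi); last by move=> /Isub[]; rewrite (negPf xP).
move: x; apply: (@seq_up_ind _ _ _ height) => x xP IH Ix xy.
have [<-//|xNy] := eqVneq x y.
have [_ x0] := (posrootP x).1 (Isub _ Ix).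
have [i xiP xiy] := root_climb _ _ xP x0 yP xy xNy.
apply: (IH (x + simple i)) => //; first by rewrite heightD height_simple ltrDl ltr01.
rewrite addrC; apply: Iup => //; apply/posrootP.
  by split; [exact: simple_root | exact: pos_simple].
rewrite addrC; split=> //; apply: pos_le x0 _; apply/coef_leP => j.
by rewrite coefD coef_simple lerDl ler0n.
Qed.

(* Induction on the height: some simple root [i] of the support has positive
   product with [x], so [x - i] is a root and has one part empty.  If [i] alone
   was its part of [x], reflecting [x] in [i] gives coefficients of both signs. *)
Lemma root_supp_connected x (X : pred 'I_(size Pi)) : x \in Phi -> pos x ->
  (forall i j, X i -> ~~ X j -> 0 < coef x i -> 0 < coef x j ->
    dot (simple i) (simple j) = 0) ->
  (forall i, X i -> coef x i = 0) \/ (forall i, ~~ X i -> coef x i = 0).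
Proof.
move=> xP; move: x xP X; apply: (@seq_down_ind _ _ _ height) => x xP IH.
(* The conclusion is symmetric in [X] and its complement, so the simple root with positive product
   can be taken in [X]. *)
suff main i (X : pred 'I_(size Pi)) : pos x -> X i -> 0 < coef x i -> 0 < dot (simple i) x ->
    (forall j k, X j -> ~~ X k -> 0 < coef x j -> 0 < coef x k ->
      dot (simple j) (simple k) = 0) ->
    (forall j, X j -> coef x j = 0) \/ (forall j, ~~ X j -> coef x j = 0).
  move=> X x0 orth; have := root_gt0 rsPhi _ xP.
  have [/existsP[i /andP[xi ix]] _|/existsPn H] :=
    boolP [exists i, (0 < coef x i) && (0 < dot (simple i) x)]; last first.
    rewrite dot_coefl ltNge sumr_le0 // => i _.
    have := H i; have := posP _ x0 i; rewrite le_eqVlt => /predU1P[<-|xi].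
      by rewrite mul0r.
    by rewrite xi -leNgt; apply: mulr_ge0_le0; rewrite ltW.
  have [Xi|nXi] := boolP (X i); first exact: (main i).
  have [|H'|H'] := main i (predC X) x0 nXi xi ix.
  - by move=> j k /= nXj /negbNE Xk xj xk; rewrite dotC orth.
  - by right.
  - by left => j Xj; apply: H'; rewrite /= negbK.
move=> x0 Xi xi ix orth.
have [->|xNi] := eqVneq x (simple i).
  right=> j nXj; rewrite coef_simple; case: eqVneq => // ij.
  by move: nXj; rewrite -ij Xi.
have xiP : x - simple i \in Phi.
  by apply: (root_sub rsPhi) => //; [exact: simple_root | rewrite dotC].
have le1 j : coef (x - simple i) j <= coef x j.
  by rewrite coefB coef_simple gerBl ler0n.
have xi0 : pos (x - simple i).
  apply/posP => j; rewrite coefB coef_simple; case: eqVneq => [<-|_].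
    by rewrite subr_ge0 coef_ge1.
  by rewrite subr0; apply/posP.
have eqc j : ~~ X j -> coef (x - simple i) j = coef x j.
  move=> nXj; rewrite coefB coef_simple; case: eqVneq => [ij|]; last by rewrite subr0.
  by move: nXj; rewrite -ij Xi.
have ltx : height (x - simple i) < height x.
  by rewrite heightD heightN height_simple gtrBl ltr01.
have [|zX|zX] := IH _ xiP ltx X xi0.
- by move=> j k Xj nXk xj xk; apply: orth; rewrite ?(lt_le_trans _ (le1 _)).
- right=> j nXj; apply/eqP; rewrite eq_le (posP _ x0) andbT leNgt; apply/negP => xj.
  have orthi : dot (simple i) (x - simple i) = 0.
    rewrite dotC dot_coefl big1 // => k _.
    have [Xk|nXk] := boolP (X k); first by rewrite zX // mul0r.
    have := posP _ x0 k; rewrite le_eqVlt eqc // => /predU1P[<-|xk].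
      by rewrite mul0r.
    by rewrite dotC orth ?mulr0.
  have refl_coef k : coef (refl (simple i) x) k = coef x k - 2 * (i == k)%:R.
    have e : dot x (simple i) = dot (simple i) (simple i).
      by apply/eqP; rewrite -subr_eq0 -dotBl dotC orthi.
    by rewrite /refl e coefB coefZ coef_simple mulfK // gt_eqF ?simple_gt0.
  have ij : (i == j) = false by apply: contraNF nXj => /eqP <-.
  have sP := root_refl rsPhi _ _ (simple_root i) xP.
  have := root_pos _ j sP; rewrite refl_coef ij mulr0 subr0 => /(_ xj)/posP/(_ i).
  rewrite refl_coef eqxx; have := zX i Xi; rewrite coefB coef_simple eqxx; lra.
- by right=> j nXj; rewrite -eqc // zX.
Qed.

(** * Products with simple roots outside the support, and roots dominant on a subset *)

Lemma dot_simple_coef0_le0 x i : pos x -> coef x i = 0 -> dot (simple i) x <= 0.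
Proof.
move=> /posP x0 xi; rewrite dotC dot_coefl sumr_le0 // => j _.
have [->|ji] := eqVneq j i; first by rewrite xi mul0r.
by rewrite mulr_ge0_le0 // dot_simple_le0.
Qed.

(** Since [i] is outside the support of [x], its product with [x] is a sum of terms that are all at
    most 0; if the sum is nonnegative, each term vanishes. *)
Lemma dot_simple_supp0 x i j : pos x -> coef x i = 0 -> 0 <= dot (simple i) x ->
  0 < coef x j -> dot (simple j) (simple i) = 0.
Proof.
move=> x0 xi ix xj; have /posP x0' := x0; apply/eqP.
have ji : j != i by apply: contraTneq xj => ->; rewrite xi ltxx.
rewrite eq_le dot_simple_le0 //= leNgt; apply: contraTN ix => ij; rewrite -ltNge.
rewrite dotC dot_coefl (bigD1 j) //= ltr_wnDr ?pmulr_rlt0 // sumr_le0 // => k _.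
have [->|ki] := eqVneq k i; first by rewrite xi mul0r.
by rewrite mulr_ge0_le0 // dot_simple_le0.
Qed.

(* The support of such a [kappa] is the connected component of [d] in [Y]. *)
Lemma exists_dominant_in (Y : pred 'I_(size Pi)) d : Y d ->
  exists kappa, [/\ kappa \in Phi, 0 < coef kappa d,
    dot kappa kappa = dot (simple d) (simple d),
    forall i, ~~ Y i -> coef kappa i = 0 &
    forall i, Y i -> 0 <= dot (simple i) kappa].
Proof.
(* The witness has maximal height among the roots supported in [Y], with [d] in the support and the
   length of [d]. Reflecting in a simple root of [Y] with negative product would keep these
   properties and increase the height. *)
move=> Yd; pose P x := [&& 0 < coef x d, dot x x == dot (simple d) (simple d) &
  [forall i, ~~ Y i ==> (coef x i == 0)]].
have hasP : has P Phi.
  apply/hasP; exists (simple d); first exact: simple_root.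
  rewrite /P coef_simple !eqxx ltr01 /=; apply/forallP => i; apply/implyP => nYi.
  by rewrite coef_simple; case: (eqVneq d i) nYi => [<-|_ _]; rewrite ?Yd ?eqxx.
have [x [xP /and3P[xd /eqP xx /forallP xY] xmax]] := exists_argmax _ height _ hasP.
exists x; split=> // [i nYi|i Yi]; first exact/eqP/(implyP (xY i)).
rewrite leNgt; apply/negP; rewrite dotC => xi.
have i0 := simple_gt0 i.
have a0 : 0 < - (2 * dot x (simple i) / dot (simple i) (simple i)).
  by rewrite oppr_gt0 pmulr_llt0 ?invr_gt0 // pmulr_rlt0.
have := xmax _ (root_refl rsPhi _ _ (simple_root i) xP).
rewrite /P (dot_refl rsPhi) ?simple_root // xx eqxx /=.
rewrite /refl -scaleNr; set a := - _ in a0 *.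
rewrite heightD heightZ height_simple mulr1 gerDl leNgt a0 => xmax'.
suff: false by []; apply: xmax'; apply/andP; split.
  by rewrite coefD coefZ coef_simple ltr_wpDr // mulr_ge0 ?ler0n ?ltW.
apply/forallP => j; apply/implyP => nYj.
rewrite coefD coefZ coef_simple (eqP (implyP (xY j) nYj)) add0r.
by case: (eqVneq i j) nYj => [<-|_ _]; rewrite ?Yi ?mulr0.
Qed.

(** * The highest root *)

Variable theta : 'rV[R]_n.
Hypothesis theta_highest : highest_root Phi Pi theta.

Lemma theta_root : theta \in Phi.
Proof. by case: theta_highest => /posrootP[]. Qed.

Lemma theta_pos : pos theta.
Proof. by case: theta_highest => /posrootP[]. Qed.

Lemma coef_le_theta x : x \in Phi -> coef_le x theta.
Proof.
move=> xP; have [x0|/posP x0] := root_pos_or_neg _ xP.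
  apply/(rprecP _ _ xP theta_root); case: theta_highest => _; apply.
  exact/posrootP.
apply/coef_leP => i; apply: le_trans (posP _ theta_pos i).
by rewrite -oppr_ge0 -coefN.
Qed.

Lemma coef_theta_gt0 i : 0 < coef theta i.
Proof.
have /coef_leP/(_ i) := coef_le_theta _ (simple_root i).
by rewrite coef_simple eqxx; apply/lt_le_trans/ltr01.
Qed.

Lemma theta_dominant i : 0 <= dot (simple i) theta.
Proof.
rewrite leNgt dotC; apply/negP => lt0.
have /coef_leP/(_ i) : coef_le (theta + simple i) theta.
  apply/coef_le_theta/(root_add rsPhi) => //; [exact: theta_root | exact: simple_root|].
  by rewrite posrootD_neq0 ?theta_pos ?theta_root ?pos_simple.
by rewrite coefD coef_simple eqxx leNgt ltrDl ltr01.
Qed.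

Lemma dot_theta_ge0 x : pos x -> 0 <= dot x theta.
Proof.
move=> /posP x0; rewrite dot_coefl sumr_ge0 // => i _.
by rewrite mulr_ge0 // theta_dominant.
Qed.

(** Reflections in simple roots with negative product raise a positive root without changing its
    length. Once [x] is dominant, [theta - x] has nonnegative products with both [x] and [theta], so
    (x,x) <= (theta,x) <= (theta,theta). *)
Lemma theta_long x : x \in Phi -> dot x x <= dot theta theta.
Proof.
move=> xP; wlog x0 : x xP / pos x.
  move=> H; have [/H->//|/H] := root_pos_or_neg _ xP.
  by rewrite !dotp opprK; apply; apply: root_opp.
move: x xP x0; apply: (@seq_up_ind _ _ _ height) => x xP IH x0.
have [/existsP[i xi]|/existsPn xdom] := boolP [exists i, dot (simple i) x < 0].
  have a0 : 0 < - (2 * dot x (simple i) / dot (simple i) (simple i)).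
    by rewrite oppr_gt0 pmulr_llt0 ?invr_gt0 ?simple_gt0 // pmulr_rlt0 // dotC.
  rewrite -(dot_refl rsPhi _ _ (simple_root i)); apply: IH.
  - exact/root_refl/xP/simple_root.
  - by rewrite /refl -scaleNr heightD heightZ height_simple mulr1 ltrDl.
  - apply/posP => j; rewrite /refl -scaleNr coefD coefZ coef_simple.
    by rewrite addr_ge0 ?mulr_ge0 ?ler0n ?(posP _ x0) // ltW.
have le1 : dot x x <= dot theta x.
  rewrite -subr_ge0 -dotBl dot_coefl sumr_ge0 // => i _; rewrite mulr_ge0 //.
    by rewrite coefB subr_ge0; apply/coef_leP/coef_le_theta.
  by rewrite leNgt.
apply: le_trans le1 _; rewrite dotC -subr_ge0 -dotBl; apply: dot_theta_ge0.
by apply/posP => i; rewrite coefB subr_ge0; apply/coef_leP/coef_le_theta.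
Qed.

(** As [theta] is long, the hypothesis makes the norm of [x - theta] at most 0. *)
Lemma eq_theta x : x \in Phi -> dot theta theta <= dot x theta -> x = theta.
Proof.
move=> xP le1; apply/eqP; rewrite -subr_eq0 -dotxx_eq0 eq_le dotxx_ge0 andbT.
have := theta_long _ xP; move: le1; rewrite !dotp (dotC theta x); lra.
Qed.

(** * Abelian ideals and pairs with sum [theta] *)

Lemma nonabelian_ideal_theta (J : 'rV[R]_n -> Prop) x y : upper_ideal Phi Pi J ->
  J x -> J y -> x + y \in Phi -> exists2 z, J z & J (theta - z).
Proof.
move=> Jup Jx Jy xyP; have [Jsub _] := Jup.
have Jpos u : J u -> u \in Phi /\ pos u by move=> /Jsub/posrootP.
(* The sum [s] climbs to [theta] by simple roots. At each step [root_add3] lets one of the two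
   summands absorb the simple root, and it stays in the upper ideal. *)
suff main s : s \in Phi -> forall x y, x + y = s -> J x -> J y ->
    exists2 z, J z & J (theta - z) by exact: main xyP x y erefl Jx Jy.
move: s {x y Jx Jy xyP}.
apply: (@seq_up_ind _ _ _ height) => s sP IH x y es Jx Jy.
have [sth|sNth] := eqVneq s theta; first by exists x => //; rewrite -sth -es addrC addKr.
have [[xP x0] [yP y0]] := (Jpos _ Jx, Jpos _ Jy).
have s0 : pos s.
  by apply/posP => i; rewrite -es coefD addr_ge0 //; apply/posP.
have [i siP _] := root_climb _ _ sP s0 theta_root (coef_le_theta _ sP) sNth.
have lts : height s < height (s + simple i) by rewrite heightD height_simple ltrDl ltr01.
have up u : J u -> u + simple i \in Phi -> J (u + simple i).
  move=> Ju uiP; apply: upper_ideal_coef_le Jup Ju uiP _.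
  by apply: (coef_le_addl _ _ i); exact: coef_le_refl.
have [||||xiP|yiP] := root_add3 rsPhi x y (simple i) xP yP (simple_root i).
- by rewrite es.
- by rewrite es.
- by rewrite posrootD_neq0 ?pos_simple.
- by rewrite posrootD_neq0 ?pos_simple.
- by apply: (IH _ siP lts (x + simple i) y) => //; [rewrite addrAC es | apply: up].
- by apply: (IH _ siP lts x (y + simple i)) => //; [rewrite addrA es | apply: up].
Qed.

(** Adjoin to [I] all roots above [x]. The hypothesis puts every root of H above [x] also above [y],
    hence in [I], so the intersection with H is unchanged. The enlarged ideal is abelian because a
    violation would give a pair with sum [theta]; such a pair lies in H, hence in [I]. *)
Lemma Imax_descent mu I x y : is_Imax Phi Pi theta mu I -> x \in Phi -> pos x ->
  (forall z, z \in Phi -> 0 < dot z theta -> coef_le x z -> coef_le y z) ->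
  I y -> I x.
Proof.
move=> [s [_ [_ [Iup Iab]] IH Imax]] xP x0 xy Iy.
have IHset z : z \in Phi -> 0 < dot z theta -> coef_le x z -> I z.
  by move=> zP zth xz; apply: upper_ideal_coef_le Iup Iy zP (xy _ zP zth xz).
pose J z := I z \/ z \in Phi /\ coef_le x z.
have Jup : upper_ideal Phi Pi J.
  split=> [z [/(Iup.1)//|[zP xz]]|g v].
    by apply/posrootP; split=> //; apply: pos_le x0 xz.
  move=> [Ig|[gP xg]] vP vgP; first by left; apply: Iup.2.
  right; case/posrootP: vP => _ /posP v0; case: vgP => vgP _; split=> //.
  by apply: coef_le_trans xg _; apply/coef_leP => i; rewrite coefD lerDr.
have JI z : J z -> 0 < dot z theta -> I z by move=> [//|[zP xz] zth]; apply: IHset.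
apply: (Imax J); last by right; rewrite coef_le_refl.
- split; [by exists y; left | split=> //] => g1 g2 Jg1 Jg2 /posrootP[g12P _].
  have [z Jz Jz'] := nonabelian_ideal_theta _ _ _ Jup Jg1 Jg2 g12P.
  have theta0 : theta \notin [:: 0] by rewrite inE (root_neq0 rsPhi) ?theta_root.
  (* If [theta - u] were orthogonal to [theta], then [u] would equal [theta], and [theta - u] would
     be 0, which is not a root. *)
  have gt0 u : J u -> J (theta - u) -> 0 < dot (theta - u) theta.
    move=> /(Jup.1)/posrootP[uP _] /(Jup.1)/posrootP[vP v0].
    rewrite lt_def dot_theta_ge0 // andbT; apply: contraNneq (root_neq0 rsPhi _ vP).
    rewrite dotBl => /eqP; rewrite subr_eq0 => /eqP e.
    by rewrite (eq_theta u uP) ?subrr // e.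
  have Iz' : I (theta - z) by apply: JI => //; apply: gt0.
  have Iz : I z.
    by apply: JI => //; have := gt0 (theta - z); rewrite subKr; apply.
  apply: (Iab _ _ Iz Iz'); rewrite addrC subrK; apply/posrootP.
  by split; [exact: theta_root | exact: theta_pos].
- move=> z; split=> [[Jz Hz]|/IH[Iz Hz]]; last by split=> //; left.
  by apply/IH; split=> //; apply: JI => //; case: Hz.
Qed.

(** * The unique simple ascent towards a node outside the support *)

(* Two such ascents [d], [d'] would close a cycle in the Dynkin diagram through
   the supports of [x] and [kappa]: for [d] the shorter one and [k] conjugate to
   [d] with the same support as [kappa], [(k + x, k + x) <= 0]. *)
Lemma ascent_unique x kappa d d' : x \in Phi -> pos x -> kappa \in Phi ->
  (forall i, coef x i != 0 -> coef kappa i = 0) ->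
  0 < coef kappa d -> 0 < coef kappa d' ->
  dot (simple d) x < 0 -> dot (simple d') x < 0 -> d = d'.
Proof.
move=> xP x0 kP kx; wlog dd' : d d' / dot (simple d) (simple d) <=
    dot (simple d') (simple d').
  move=> H kd kd' xd xd'.
  by have /orP[/H->//|/H->]
    := le_total (dot (simple d) (simple d)) (dot (simple d') (simple d')).
move=> kd kd' xd xd'; apply/eqP/negPn/negP => dNd'.
pose Y i := coef x i == 0.
have Yk i : 0 < coef kappa i -> Y i by apply: contraTT => /kx ->; rewrite ltxx.
have [k1 [k1P k1d k1k1 k1Y k1dom]] := exists_dominant_in Y d (Yk d kd).
have k10 := root_pos _ _ k1P k1d.
(* The support of [kappa] is connected and lies in [Y]. No node of [Y] outside the support of [k1]
   is adjacent to that support, so the support of [k1] contains all of the support of [kappa]. *)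
have k1d' : 0 < coef k1 d'.
  have [i j k1i|/(_ d k1d)/eqP|]
    := root_supp_connected _ (fun i => 0 < coef k1 i) kP (root_pos _ _ kP kd).
  - rewrite lt_def (posP _ k10) andbT negbK => /eqP k1j _ kj.
    exact: dot_simple_supp0 k10 k1j (k1dom _ (Yk _ kj)) k1i.
  - by rewrite gt_eqF.
  - move=> /(_ d')H; apply: contraTT kd' => /H ->; by rewrite ltxx.
have le2 : dot k1 x <= dot (simple d) x + dot (simple d') x.
  rewrite dot_coefl (bigD1 d) //= (bigD1 d') 1?eq_sym //= addrA -[leRHS]addr0.
  apply: lerD; first apply: lerD.
  - by rewrite ler_neMl ?(ltW xd) // coef_ge1.
  - by rewrite ler_neMl ?(ltW xd') // coef_ge1.
  - rewrite sumr_le0 // => i _; have [/eqP xi|/k1Y->] := boolP (Y i); last by rewrite mul0r.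
    by rewrite mulr_ge0_le0 ?(posP _ k10) // dot_simple_coef0_le0.
(* The bounds 2(d,x) <= -(d,d) and 2(d',x) <= -(x,x), with (k1,k1) = (d,d), make the norm of
   [k1 + x] at most 0, although this sum is not 0. *)
have le_d := cartan_lt0 rsPhi _ _ xP (simple_root d) xd.
have le_d' := cartan_lt0 rsPhi _ _ xP (simple_root d') xd'.
rewrite dotC in xd; have le_xd := cartan_lt0 rsPhi _ _ (simple_root d) xP xd.
rewrite dotC in xd'; have le_xd' := cartan_lt0 rsPhi _ _ (simple_root d') xP xd'.
have /negP := posrootD_neq0 _ _ k1P k10 x0; apply.
rewrite -dotxx_eq0 eq_le dotxx_ge0 andbT !dotp (dotC x k1) k1k1.
move: le2 le_d le_d' le_xd le_xd' dd'; rewrite !(dotC x); lra.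
Qed.

(** Let [k] be supported on the component of [t] in the complement of the support of [x]. A root
    above [x] containing [t] has connected support, so it contains some [d] in the support of [k]
    adjacent to that of [x]. By [ascent_unique] this [d] does not depend on the root; taking [theta]
    shows that it exists. *)
Lemma unique_ascent t x : x \in Phi -> pos x -> coef x t = 0 ->
  exists2 d, x + simple d \in Phi &
    forall y, y \in Phi -> 0 < coef y t -> coef_le x y -> coef_le (x + simple d) y.
Proof.
move=> xP x0 xt; pose Y i := coef x i == 0.
have [k [kP kt _ kY kdom]] := exists_dominant_in Y t (introT eqP xt).
have k0 := root_pos _ _ kP kt.
have ascent y : y \in Phi -> 0 < coef y t -> coef_le x y ->
    exists d, [/\ 0 < coef k d, dot (simple d) x < 0 & 0 < coef y d].
  move=> yP yt /coef_leP xy.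
  suff /existsP[d /and3P[]] : [exists d, [&& 0 < coef k d, dot (simple d) x < 0 &
    0 < coef y d]] by exists d.
  apply: contraT => /existsPn N.
  (* Without such a [d], the nodes of [y] inside the support of [k] would be orthogonal to the other
     nodes of [y], against connectedness. *)
  have [i j ki nkj yi yj|/(_ t kt)/eqP|H] :=
    root_supp_connected _ (fun i => 0 < coef k i) yP (root_pos _ _ yP yt).
  - have kj : coef k j = 0.
      by apply/eqP; move: nkj; rewrite lt_def (posP _ k0) andbT negbK.
    have [Yj|nYj] := boolP (Y j).
      exact: dot_simple_supp0 k0 kj (kdom _ Yj) ki.
    have /eqP xi : Y i by apply: contraTT ki => /kY ->; rewrite ltxx.
    rewrite dotC; apply: (dot_simple_supp0 x i j x0 xi).
      by have := N i; rewrite ki yi andbT /= -leNgt.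
    by rewrite lt_def nYj (posP _ x0).
  - by rewrite gt_eqF.
  - have [i xi] := pos_coef_gt0 _ xP x0; have := lt_le_trans xi (xy i).
    by rewrite H ?ltxx // kY ?ltxx // /Y gt_eqF.
have [d [kd xd _]] := ascent _ theta_root (coef_theta_gt0 t) (coef_le_theta _ xP).
have Yd : coef x d = 0 by apply/eqP; apply: contraTT kd => /kY ->; rewrite ltxx.
exists d => [|y yP yt xy].
  apply: (root_add rsPhi) => //; [exact: simple_root | by rewrite dotC |].
  by rewrite posrootD_neq0 ?pos_simple.
have [d' [kd' xd' yd']] := ascent _ yP yt xy.
apply: coef_le_add_simple => //; rewrite Yd.
by rewrite (ascent_unique x k d d').
Qed.

(** * Enumerations of the simple roots along the Dynkin diagram *)

Lemma mem_full_seq (s : seq 'I_(size Pi)) : uniq s -> size s = size Pi ->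
  forall i, i \in s.
Proof.
move=> us ss i; have cs : #|s| = #|'I_(size Pi)| by rewrite (card_uniqP us) ss card_ord.
by rewrite (subset_cardP cs (subset_predT (mem s))).
Qed.

Lemma coef_sum_simple (s : seq 'I_(size Pi)) i : uniq s ->
  coef (\sum_(j <- s) simple j) i = (i \in s)%:R.
Proof.
elim: s => [|j s IH] /=; first by rewrite big_nil coef0.
case/andP => js us; rewrite big_cons coefD IH // coef_simple inE eq_sym.
by case: eqVneq js => [->|_ _]; [move/negPf-> => /=; rewrite addr0 | rewrite add0r].
Qed.

(** The support of [theta] is the whole base and is connected, so while simple roots remain, one of
    them has negative product with the sum of those already listed. Appending it gives a root
    again. *)
Lemma exists_growing_order a m : (m < size Pi)%N ->
  exists s : seq 'I_(size Pi),
  [/\ uniq s, size s = m.+1, nth a s 0 = a, \sum_(i <- s) simple i \in Phi &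
    forall q, (0 < q < size s)%N -> exists2 p, (p < q)%N &
      dot (simple (nth a s p)) (simple (nth a s q)) < 0].
Proof.
elim: m => [_|m IH ltm].
  exists [:: a]; split=> //; first by rewrite big_seq1 simple_root.
  by case.
have [s [us ss s0 sP sadj]] := IH (ltnW ltm).
set sigma := \sum_(i <- s) _ in sP.
have csig i : coef sigma i = (i \in s)%:R by apply: coef_sum_simple.
have sig0 : pos sigma by apply/posP => i; rewrite csig ler0n.
have as_ : a \in s by rewrite -s0 mem_nth // ss.
have [i0 i0s] : exists i0, i0 \notin s.
  apply/existsP; apply: contraLR ltm => /existsPn H; rewrite -leqNgt -ss.
  rewrite -[X in (X <= _)%N]card_ord -(card_uniqP us); apply/subset_leq_card/subsetP.
  by move=> i _; have := H i; rewrite negbK.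
have /existsP[i /andP[ins si]] :
    [exists i, (i \notin s) && (dot (simple i) sigma < 0)].
  apply: contraT => /existsPn H.
  have [i j is_ njs _ _|/(_ a as_)/eqP|/(_ i0 i0s)/eqP] :=
      root_supp_connected _ (fun i => i \in s) theta_root theta_pos.
  - apply: (dot_simple_supp0 sigma) => //.
    + by rewrite csig (negPf njs).
    + by have := H j; rewrite njs -leNgt.
    + by rewrite csig is_ ltr01.
  - by rewrite gt_eqF // coef_theta_gt0.
  - by rewrite gt_eqF // coef_theta_gt0.
exists (rcons s i); split.
- by rewrite rcons_uniq ins.
- by rewrite size_rcons ss.
- by rewrite nth_rcons ss.
- rewrite -cats1 big_cat big_seq1 -/sigma; apply: (root_add rsPhi) => //.
  + exact: simple_root.
  + by rewrite dotC.
  + by rewrite posrootD_neq0 ?pos_simple.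
- move=> q; rewrite size_rcons ltnS => /andP[q0].
  rewrite leq_eqVlt => /predU1P[->|qs]; last first.
    have [|p pq adj] := sadj q; first by rewrite q0.
    by exists p => //; rewrite !nth_rcons qs (ltn_trans pq qs).
  have [|/existsPn H] := boolP [exists p : 'I_(size s),
      dot (simple (nth a s p)) (simple i) < 0].
    by move/existsP=> [p]; exists p => //; rewrite !nth_rcons ltnn eqxx ltn_ord.
  move: si; rewrite dotC dot_suml ltNge big_seq sumr_ge0 // => j js.
  have := H (Ordinal (ltac:(by rewrite index_mem) : (index j s < size s)%N)).
  by rewrite /= nth_index // -leNgt.
Qed.

(** * Two simple roots not orthogonal to [theta] force type A *)

Section TwoNodes.
Variables a b : 'I_(size Pi).
Hypotheses (ab : a != b) (a_theta : 0 < dot (simple a) theta)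
  (b_theta : 0 < dot (simple b) theta).

(** The sum of all simple roots is a root. Its product with [theta] is at least (theta,theta), since
    [a] and [b] contribute at least half of it each. *)
Lemma theta_sum : theta = \sum_i simple i.
Proof.
have [|s [us ss _ sP _]] := exists_growing_order a (size Pi).-1.
  by rewrite prednK // (leq_ltn_trans _ (ltn_ord a)).
rewrite prednK ?(leq_ltn_trans _ (ltn_ord a)) // in ss.
have ms := mem_full_seq s us ss.
have es : \sum_(i <- s) simple i = \sum_i simple i.
  by apply: coef_inj => i; rewrite !coef_sum_simple ?index_enum_uniq // ms mem_index_enum.
apply/esym/eq_theta; rewrite -es // es dot_suml (bigD1 a) //= (bigD1 b) 1?eq_sym //=.
have := cartan_gt0 rsPhi _ _ theta_root (simple_root a) a_theta.
have := cartan_gt0 rsPhi _ _ theta_root (simple_root b) b_theta.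
have : 0 <= \sum_(i | (i != a) && (i != b)) dot (simple i) theta.
  by apply: sumr_ge0 => i _; apply: theta_dominant.
lra.
Qed.

(** Each neighbour contributes at most -(k,k)/2 to the product of [k] with [theta], so three of them
    would contradict dominance. *)
Lemma at_most_two_neighbours k i j l : uniq [:: k; i; j; l] ->
  dot (simple i) (simple k) < 0 -> dot (simple j) (simple k) < 0 ->
  0 <= dot (simple l) (simple k).
Proof.
rewrite /= !inE !negb_or => /and4P[/and3P[ki kj kl] /andP[ij il] jl _] ik jk.
rewrite leNgt; apply/negP => lk.
have := theta_dominant k; rewrite dotC theta_sum dot_suml.
rewrite (bigD1 k) //= (bigD1 i) 1?eq_sym //= (bigD1 j) /=; last by rewrite !(eq_sym j) kj ij.
rewrite (bigD1 l) /=; last by rewrite !(eq_sym l) kl il jl.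
have := cartan_lt0 rsPhi _ _ (simple_root k) (simple_root i) ik.
have := cartan_lt0 rsPhi _ _ (simple_root k) (simple_root j) jk.
have := cartan_lt0 rsPhi _ _ (simple_root k) (simple_root l) lk.
set S := \sum_(_ | _) _.
have : S <= 0.
  by apply: sumr_le0 => m /andP[/andP[/andP[mk _] _] _]; apply: dot_simple_le0.
have := simple_gt0 k; lra.
Qed.

(** Here the product with [theta] is strictly positive, so already two neighbours are too many: [a]
    is an end of the diagram. *)
Lemma at_most_one_neighbour i j : uniq [:: a; i; j] ->
  dot (simple i) (simple a) < 0 -> 0 <= dot (simple j) (simple a).
Proof.
rewrite /= !inE !negb_or => /and3P[/andP[ai aj] ij _] ia.
rewrite leNgt; apply/negP => ja.
have := a_theta; rewrite dotC theta_sum dot_suml.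
rewrite (bigD1 a) //= (bigD1 i) 1?eq_sym //= (bigD1 j) /=; last by rewrite !(eq_sym j) aj ij.
have := cartan_lt0 rsPhi _ _ (simple_root a) (simple_root i) ia.
have := cartan_lt0 rsPhi _ _ (simple_root a) (simple_root j) ja.
set S := \sum_(_ | _) _.
have : S <= 0.
  by apply: sumr_le0 => m /andP[/andP[ma _] _]; apply: dot_simple_le0.
lra.
Qed.

(** In a growing order from the end [a], each new node attaches to the last one: every earlier node
    already has all the neighbours it may have. *)
Lemma exists_path_order : exists s : seq 'I_(size Pi),
  [/\ uniq s, size s = size Pi,
    forall p, (p.+1 < size Pi)%N ->
      dot (simple (nth a s p)) (simple (nth a s p.+1)) < 0 &
    forall p q, (p.+1 < q < size Pi)%N ->
      dot (simple (nth a s p)) (simple (nth a s q)) = 0].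
Proof.
have N0 : (0 < size Pi)%N by rewrite (leq_ltn_trans _ (ltn_ord a)).
have [|s [us ss s0 _ sadj]] := exists_growing_order a (size Pi).-1; first by rewrite prednK.
rewrite prednK // in ss; pose c p := simple (nth a s p).
have nth_eq p q : (p < size Pi)%N -> (q < size Pi)%N -> (nth a s p == nth a s q) = (p == q).
  by move=> pN qN; rewrite nth_uniq ?ss.
have nonadj p q : (p.+1 < q < size Pi)%N -> dot (c p) (c p.+1) < 0 ->
    ((0 < p)%N -> dot (c p.-1) (c p) < 0) -> 0 <= dot (c p) (c q).
  move=> /andP[pq qN] adj1 adj0; rewrite dotC; rewrite dotC in adj1.
  case: p pq adj1 adj0 => [|p] pq adj1 adj0.
    have u : uniq [:: nth a s 0; nth a s 1; nth a s q].
      by rewrite /= !inE !nth_eq //; lia.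
    by rewrite /c s0 in u adj1 *; apply: at_most_one_neighbour adj1.
  apply: at_most_two_neighbours adj1 (adj0 isT).
  by rewrite /= !inE !nth_eq //; lia.
have chain p : (p.+1 < size Pi)%N -> dot (c p) (c p.+1) < 0.
  elim/ltn_ind: p => p IH pN.
  have [|r rp adj] := sadj p.+1; first by rewrite ss.
  move: rp; rewrite ltnS leq_eqVlt => /predU1P[erp|rp]; first by rewrite erp in adj.
  have := nonadj r p.+1; rewrite leNgt adj ltnS rp pN => /(_ isT) H.
  suff: false by []; apply: H; first by apply: IH => //; lia.
  by case: r rp {adj} => // r rp _; apply: IH; lia.
exists s; split=> // p q pqN; apply/eqP; rewrite eq_le dot_simple_le0 /=; last first.
  by rewrite nth_eq; lia.
apply: nonadj => //; first by apply: chain; lia.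
by case: p pqN => // p pqN _; apply: chain; lia.
Qed.

(** The positive roots are the sums [itv p q] over intervals of the path, and the linear map sending
    the simple root in position [p] to [e p - e p.+1] sends [itv p q] to [e p - e q]. *)
Lemma two_nodes_typeA : typeA Phi.
Proof.
have N0 : (0 < size Pi)%N by rewrite (leq_ltn_trans _ (ltn_ord a)).
have [s [us ss chain far]] := exists_path_order.
have ms := mem_full_seq s us ss.
have idx_lt i : (index i s < size Pi)%N by have := ms i; rewrite -index_mem ss.
pose c p := simple (nth a s p); pose itv p q := \sum_(p <= k < q) c k.
have coef_c p i : (p < size Pi)%N -> coef (c p) i = (p == index i s)%:R.
  move=> pN; rewrite coef_simple -[in LHS](nth_index a (ms i)).
  by rewrite nth_uniq ?ss ?idx_lt.
have coef_itv p q i : (q <= size Pi)%N -> coef (itv p q) i = (p <= index i s < q)%:R.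
  move=> qN; rewrite coef_sum; have [pq|qp] := leqP p q; last first.
    have -> : (p <= index i s < q)%N = false by lia.
    by rewrite big_geq // ltnW.
  have [/andP[pi iq]|H] := boolP (p <= index i s < q)%N.
    rewrite (bigD1_seq (index i s)) ?iota_uniq ?mem_index_iota ?pi //=.
    rewrite coef_c // eqxx big_seq_cond big1 ?addr0 // => k.
    rewrite mem_index_iota => /andP[kpq /negPf ki].
    by rewrite coef_c ?ki //; lia.
  rewrite big_seq big1 // => k; rewrite mem_index_iota => kpq.
  rewrite coef_c; last by lia.
  by case: eqVneq => // e; move: H; rewrite -e kpq.
have itv_root p q : (p < q <= size Pi)%N -> itv p q \in Phi.
  case/andP; elim: q => // q IH; rewrite ltnS leq_eqVlt => /predU1P[->|pq] qN.
    by rewrite /itv big_nat1 simple_root.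
  have itvP := IH pq (ltnW qN).
  have itv0 : pos (itv p q) by apply/posP => i; rewrite coef_itv ?ler0n // ltnW.
  rewrite /itv big_nat_recr /= ?(ltnW pq) //; apply: (root_add rsPhi) => //.
  - exact: simple_root.
  - rewrite dot_suml -(prednK (leq_ltn_trans (leq0n p) pq)) big_nat_recr /=; last by lia.
    rewrite ltr_wnDl //; last by apply: chain; lia.
    by rewrite big_seq sumr_le0 // => k; rewrite mem_index_iota => kp; rewrite far //; lia.
  - by rewrite posrootD_neq0 ?pos_simple.
have root_itv x : x \in Phi -> pos x -> exists p q, (p < q <= size Pi)%N /\ x = itv p q.
  (* All coordinates of [theta] are 1, so a positive root is determined by its support. *)
  move=> xP x0; have coefx i : coef x i = (0 < coef x i)%R%:R.
    have /coef_leP/(_ i) := coef_le_theta _ xP.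
    rewrite theta_sum coef_sum_simple ?index_enum_uniq // mem_index_enum => le1.
    have := posP _ x0 i; rewrite le_eqVlt => /predU1P[<-|xi]; first by rewrite ltxx.
    by rewrite xi; apply/eqP; rewrite eq_le le1 coef_ge1.
  pose P (k : nat) := (k < size Pi)%N && (0 < coef x (nth a s k)).
  have exP : exists k : nat, P k.
    have [i xi] := pos_coef_gt0 _ xP x0; exists (index i s).
    by rewrite /P idx_lt nth_index.
  have ubP (k : nat) : P k -> (k <= size Pi)%N by case/andP => /ltnW.
  case: (ex_minnP exP) => p Pp minp; case: (ex_maxnP exP ubP) => q Pq maxq.
  have pq := minp _ Pq; have /andP[qN xq] := Pq; have /andP[pN xp] := Pp.
  exists p, q.+1; split; first by rewrite ltnS pq.
  apply: coef_inj => i; rewrite coef_itv // coefx; congr (nat_of_bool _)%:R.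
  rewrite -[in LHS](nth_index a (ms i)); set k := index i s.
  have kN : (k < size Pi)%N by apply: idx_lt.
  have -> : (0 < coef x (nth a s k)) = P k by rewrite /P kN.
  apply/idP/idP => [Pk|]; first by rewrite minp // ltnS maxq.
  rewrite ltnS => /andP[pk kq]; apply: contraT => nPk.
  (* A position [k] missing between the least position [p] and the greatest position [q] would split
     the support into two orthogonal parts. *)
  have xk : coef x (nth a s k) = 0.
    by move: nPk; rewrite coefx /P kN /= => /negPf->.
  have [i1 j1 i1k j1k xi1 xj1|/(_ (nth a s p))|/(_ (nth a s q))] :=
      root_supp_connected _ (fun j => index j s < k)%N xP x0.
  - rewrite -(nth_index a (ms i1)) -(nth_index a (ms j1)); apply: far.
    have j1Nk : index j1 s != k.
      by apply: contraTneq xj1 => e; rewrite -(nth_index a (ms j1)) e xk ltxx.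
    rewrite idx_lt andbT (leq_ltn_trans i1k) // ltn_neqAle eq_sym j1Nk.
    by rewrite leqNgt.
  - rewrite index_uniq ?ss // => H; move: xp; rewrite H ?ltxx // ltn_neqAle pk andbT.
    by apply: contraNneq nPk => <-.
  - by rewrite index_uniq ?ss // -leqNgt => /(_ kq) H; move: xq; rewrite H ltxx.
pose e p : 'rV[R]_(size Pi).+1 := delta_mx 0 (inord p).
pose D := \matrix_i (e (index i s) - e (index i s).+1) : 'M_(size Pi, (size Pi).+1).
pose f := pinvmx (rowsmx Pi) *m D.
have freePi : row_free (rowsmx Pi) by case: basePi.
have fc p : (p < size Pi)%N -> c p *m f = e p - e p.+1.
  move=> pN; rewrite /c /simple -row_rowsmx -row_mul /f mulmxA (mulmxVp freePi) mul1mx.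
  by rewrite rowK index_uniq // ss.
have fitv p q : (p <= q <= size Pi)%N -> itv p q *m f = e p - e q.
  case/andP => pq qN; rewrite mulmx_suml.
  (* [telescope_sumr] sums later minus earlier terms, hence the passage to [- e]. *)
  have -> : e p - e q = - e q - - e p by rewrite opprK addrC.
  rewrite -(telescope_sumr (fun k : nat => - e k) pq) [LHS]big_seq [RHS]big_seq.
  apply: eq_bigr => k; rewrite mem_index_iota => kpq.
  by rewrite fc ?opprK 1?addrC //; lia.
exists (size Pi), f; split=> //; split.
  (* [D] takes differences of consecutive basis vectors; the 0-1 matrix [E] undoes this by partial
     summation and is a right inverse of [D]. *)
  pose E := \matrix_(k < (size Pi).+1, j < size Pi) (k <= index j s)%:R : 'M[R]_(_, _).
  have DE : D *m E = 1%:M.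
    apply/row_matrixP => i; rewrite row_mul rowK mulmxBl -!rowE.
    apply/rowP => j; rewrite !mxE !inordK ?ltnS ?idx_lt ?(ltnW (idx_lt _)) //.
    have -> : (i == j) = (index i s == index j s).
      by apply/eqP/eqP => [->|/index_inj->].
    by case: ltngtP; rewrite ?subrr ?subr0.
  apply/row_freeP; exists (E *m rowsmx Pi).
  by rewrite /f mulmxA -(mulmxA _ D) DE mulmx1 mulVpmx // base_row_full.
move=> w; split=> [[i [j [ij ->]]]|[x xP <-]].
  have eE l : e (nat_of_ord l) = delta_mx 0 l by rewrite /e inord_val.
  have [lt|lt|/val_inj eq] := ltngtP i j; last by rewrite eq eqxx in ij.
    exists (itv i j); first by rewrite itv_root // lt -ltnS ltn_ord.
    by rewrite fitv ?eE // ltnW //= -ltnS ltn_ord.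
  exists (- itv j i); first by rewrite (root_opp rsPhi) // itv_root // lt -ltnS ltn_ord.
  by rewrite mulNmx fitv ?eE ?opprB // ltnW //= -ltnS ltn_ord.
have inord_neq p q : (p < q <= size Pi)%N -> inord p != inord q :> 'I_(size Pi).+1.
  by move=> pq; rewrite -val_eqE /= !inordK; lia.
have [x0|x0] := root_pos_or_neg _ xP.
  have [p [q [pq ->]]] := root_itv _ xP x0.
  exists (inord p), (inord q); split; first exact: inord_neq.
  by rewrite fitv //; lia.
have [p [q [pq exq]]] := root_itv _ (root_opp rsPhi _ xP) x0.
exists (inord q), (inord p); split; first by rewrite eq_sym inord_neq.
by rewrite -[x]opprK exq mulNmx fitv ?opprB //; lia.
Qed.

End TwoNodes.
End Base.

(** * Maximal roots outside a union of maximal abelian ideals *)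

Theorem theorem4p2 (R : realFieldType) (n : nat) (Phi Pi : seq 'rV[R]_n)
    (theta : 'rV[R]_n) :
  root_system Phi -> irreducible Phi -> ~ typeA Phi ->
  is_base Phi Pi -> highest_root Phi Pi theta ->
  forall (S : 'rV[R]_n -> Prop),
    (forall a, S a -> a \in Pi /\ long_root Phi a) ->
  forall (Imax : 'rV[R]_n -> 'rV[R]_n -> Prop),
    (forall a, S a -> is_Imax Phi Pi theta a (Imax a)) ->
  forall gamma : 'rV[R]_n,
    (posroot Phi Pi gamma /\ ~ (exists2 a, S a & Imax a gamma)) ->
    (forall delta, posroot Phi Pi delta -> ~ (exists2 a, S a & Imax a delta) ->
       rprec Pi gamma delta -> delta = gamma) ->
    Hset Phi Pi theta gamma.
Proof.
move=> rs _ nA base hi S _ Imax HI gamma [gpos gN] gmax; split=> //.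
have [gP g0] := (posrootP rs base gamma).1 gpos.
rewrite lt_def (dot_theta_ge0 rs base theta hi) // andbT; apply/negP => /eqP gth.
have thP := theta_root rs base theta hi.
have [t tth] : exists t : 'I_(size Pi), 0 < dot (simple t) theta.
  apply/existsP; apply: contraT => /existsPn H; have := root_gt0 rs _ thP.
  rewrite (dot_coefl rs base) ltNge sumr_le0 // => i _.
  by rewrite mulr_ge0_le0 ?(ltW (coef_theta_gt0 rs base theta hi i)) // leNgt H.
have orth i : i != t -> dot (simple i) theta = 0.
  move=> it; apply/eqP; rewrite eq_le (theta_dominant rs base theta hi) andbT leNgt.
  by apply/negP => ith; case: nA; apply: (two_nodes_typeA rs base theta hi i t).
(* Membership of a positive root in H is thus decided by its coordinate at [t]. *)
have dot_theta x : dot x theta = coef x t * dot (simple t) theta.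
  rewrite (dot_coefl rs base) (bigD1 t) //= big1 ?addr0 // => i /orth->.
  by rewrite mulr0.
have gt : coef gamma t = 0.
  by move/eqP: gth; rewrite dot_theta mulf_eq0 (gt_eqF tth) orbF => /eqP.
have [d gdP gd] := unique_ascent rs base theta hi t gamma gP g0 gt.
have gle : coef_le (Pi := Pi) gamma (gamma + simple d).
  by apply: (coef_le_addl base _ _ d); exact: coef_le_refl.
(* By [Imax_descent], an ideal containing [gamma + simple d] would contain [gamma]. So this larger
   root avoids the ideals too, and maximality forces an absurd equality. *)
have e : gamma + simple d = gamma.
  apply: gmax; last exact/(rprecP rs base).
    by apply/(posrootP rs base); split=> //; apply: pos_le g0 gle.
  move=> [a Sa Ia]; apply: gN; exists a => //.
  apply: (Imax_descent rs base theta hi) (HI a Sa) gP g0 _ Ia => z zP zth gz.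
  by apply: gd => //; move: zth; rewrite dot_theta pmulr_lgt0.
have /negP := root_neq0 rs _ (simple_root base d); apply.
by rewrite -(inj_eq (addrI gamma)) e addr0.
Qed.
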